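(* Fix a positive integer $n$ and two partitions $\Lambda_w$ and $\Lambda_b$ of $n$. Then $$\sum_{T\in\mathbf{W}_{\Lambda_w,\Lambda_b}}\varepsilon(T)-\sum_{T\in\mathbf{B}_{\Lambda_w,\Lambda_b}}\varepsilon(T)=0.$$
   Context: A black and white tree is a finite tree embedded in $\mathbb{C}$ whose vertices are colored black and white so that adjacent vertices have different colors. It is real if it is invariant (including colors) under complex conjugation. Two real black and white trees are isomorphic if one is carried to the other by a homeomorphism of $\mathbb{C}$ commuting with complex conjugation, preserving the orientation of the real axis (and preserving the trees with their colors); trees are considered up to isomorphism. The real vertices of a real tree $T$ are its vertices on $\mathbb{R}$, ordered from left to right. A disorder of $T$ is a pair of real vertices of the same color such that the left one has strictly greater degree than the right one. The sign is $\varepsilon(T)=(-1)^d$, $d$ the number of disorders. $T$ is a white side (resp. black side) tree if its rightmost real vertex is white (resp. black). $\mathbf{W}_{\Lambda_w,\Lambda_b}$ (resp. $\mathbf{B}_{\Lambda_w,\Lambda_b}$) denotes the set of isomorphism classes of white side (resp. black side) real black and white trees whose white vertex degrees form the partition $\Lambda_w$ and black vertex degrees form $\Lambda_b$. *)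

(* Defs.v *)
From HB Require Import structures.
From mathcomp Require Import all_boot all_order all_algebra.
Set Implicit Arguments. Unset Strict Implicit. Unset Printing Implicit Defensive.
Import GRing.Theory Num.Theory.

(* Plane rooted trees (ordered rooted trees): a node with an ordered list   *)
(* of children (ordered counterclockwise).                                  *)
Inductive ptree := PNode of seq ptree.

Definition ptree_children (t : ptree) : seq ptree := let: PNode l := t in l.

Fixpoint ptree_enc (t : ptree) : GenTree.tree unit :=
  let: PNode l := t in GenTree.Node 0 (map ptree_enc l).

Fixpoint ptree_dec (t : GenTree.tree unit) : ptree :=
  match t with
  | GenTree.Leaf _ => PNode [::]
  | GenTree.Node _ l => PNode (map ptree_dec l)
  end.

Fixpoint ptree_encK_aux (t : ptree) : ptree_dec (ptree_enc t) = t :=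
  match t return ptree_dec (ptree_enc t) = t with
  | PNode l =>
    f_equal PNode
      ((fix F (l : seq ptree) : map ptree_dec (map ptree_enc l) = l :=
          match l return map ptree_dec (map ptree_enc l) = l with
          | [::] => erefl
          | x :: l' => f_equal2 cons (ptree_encK_aux x) (F l')
          end) l)
  end.

Lemma ptree_encK : cancel ptree_enc ptree_dec.
Proof. exact: ptree_encK_aux. Qed.

HB.instance Definition _ := Equality.copy ptree (can_type ptree_encK).

(* Colors: true = white, false = black.                                     *)
(* A real black and white tree T is encoded (uniquely up to the isomorphism *)
(* of the paper) by a pair (c, hs) where                                    *)
(*  - hs = [:: h_1; ...; h_k] (k >= 1) lists the real vertices v_1 < ... <  *)
(*    v_k from left to right (T cap R is the path v_1 - v_2 - ... - v_k);   *)
(*  - h_i is the list, in counterclockwise order, of the plane subtrees     *)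
(*    hanging from v_i into the open upper half-plane (each attached to v_i *)
(*    by one edge joining v_i to the root of the subtree); the lower        *)
(*    half-plane part is the mirror image under complex conjugation;        *)
(*  - c is the color of the rightmost real vertex v_k (colors alternate     *)
(*    along the real path).                                                 *)
Definition realtree := (bool * seq (seq ptree))%type.

Definition rt_wf (T : realtree) : bool := T.2 != [::].

(* (color, degree) of all vertices of a hanging plane tree whose root has
   color c; the root is also adjacent to its parent (one extra edge). *)
Fixpoint pt_vertices (c : bool) (t : ptree) : seq (bool * nat) :=
  let: PNode l := t in
  (c, (size l).+1) :: flatten (map (pt_vertices (~~ c)) l).

Definition rt_color (T : realtree) (i : nat) : bool :=
  T.1 (+) odd ((size T.2).-1 - i).

(* degree of the i-th real vertex: two copies (upper/lower half-planes) of
   each hanging subtree edge, plus the real edges to its real neighbours. *)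
Definition rt_degree (T : realtree) (i : nat) : nat :=
  2 * size (nth [::] T.2 i) + (0 < i) + (i < (size T.2).-1).

Definition real_vertices (T : realtree) : seq (bool * nat) :=
  [seq (rt_color T i, rt_degree T i) | i <- iota 0 (size T.2)].

(* (color, degree) of all vertices: real ones, plus each non-real vertex of
   the upper half-plane together with its mirror image. *)
Definition all_vertices (T : realtree) : seq (bool * nat) :=
  real_vertices T ++
  flatten [seq flatten [seq pt_vertices (~~ rt_color T i) t
                          ++ pt_vertices (~~ rt_color T i) t
                       | t <- nth [::] T.2 i]
          | i <- iota 0 (size T.2)].

Definition white_degrees (T : realtree) : seq nat :=
  [seq v.2 | v <- all_vertices T & v.1].
Definition black_degrees (T : realtree) : seq nat :=
  [seq v.2 | v <- all_vertices T & ~~ v.1].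

Definition disorders (T : realtree) : nat :=
  let rv := real_vertices T in
  let k := size rv in
  \sum_(0 <= i < k) \sum_(i.+1 <= j < k)
     (((nth (true, 0) rv i).1 == (nth (true, 0) rv j).1)
      && ((nth (true, 0) rv j).2 < (nth (true, 0) rv i).2)).

Definition rt_sign (T : realtree) : int := ((-1) ^+ disorders T)%R.

Definition white_side (T : realtree) : bool := T.1.
Definition black_side (T : realtree) : bool := ~~ T.1.

(* Lam is a partition of n: positive parts summing to n (as a multiset). *)
Definition is_partition (n : nat) (Lam : seq nat) : bool :=
  all (fun x => 0 < x) Lam && (sumn Lam == n).

Definition has_passport (Lw Lb : seq nat) (T : realtree) : bool :=
  rt_wf T && perm_eq (white_degrees T) Lw && perm_eq (black_degrees T) Lb.

Definition inW (Lw Lb : seq nat) (T : realtree) : bool :=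
  has_passport Lw Lb T && white_side T.
Definition inB (Lw Lb : seq nat) (T : realtree) : bool :=
  has_passport Lw Lb T && black_side T.

(* Main.v *)
(* A sign-reversing involution [flip] on all real trees of a given passport,
   for the weight (-1)^disorders, negated on black side trees.  Let k be the
   number of real vertices; the sign only depends, colour by colour, on the
   sequence of real degrees, where the ends of the path are odd and the other
   vertices even (for k > 1).
   - k even: exchange the two ends and keep the order of the interior vertices
     of each colour.  With k/2 - 1 interior vertices of each colour, the sign is
     unchanged, but the side changes.
   - k odd, ends of distinct degrees: exchanging them reverses the sign.
   - k odd, ends of equal degree: group the interior vertices of each colour in
     consecutive pairs, and exchange the first pair with distinct degrees.
   - If there is no such pair, glue the ends together, and the vertices of each
     pair together: the real axis becomes the leftmost branch of one tree hanging
     from the only real vertex left over, and the glued ends are the first vertex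
     of odd degree on that branch.  Hence this can be undone, and these trees
     cancel against the trees with k = 1. *)
Require Import Defs.
From mathcomp Require Import all_boot all_order all_algebra.
From mathcomp Require Import zify.
Set Implicit Arguments. Unset Strict Implicit. Unset Printing Implicit Defensive.
Import GRing.Theory Num.Theory.
Local Open Scope nat_scope.

(** * Disorders as inversions within each colour *)

Lemma pair_ind (T : Type) (P : seq T -> Prop) :
  P [::] -> (forall x, P [:: x]) ->
  (forall x y s, P s -> P [:: x, y & s]) -> forall s, P s.
Proof.
move=> P0 P1 P2 s; suff: P s /\ forall x, P (x :: s) by case.
elim: s => [|y s [IH1 IH2]]; split=> // x; exact: P2.
Qed.

Fixpoint inversions (s : seq nat) : nat :=
  if s is x :: s' then count (fun y => y < x) s' + inversions s' else 0.

Lemma inversions_rcons s y :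
  inversions (rcons s y) = inversions s + count (fun x => y < x) s.
Proof. by elim: s => //= x s ->; rewrite -cats1 count_cat /=; lia. Qed.

Lemma inversions_ends x s y :
  inversions (x :: rcons s y) =
    count (fun z => z < x) s + (y < x) + inversions s + count (fun z => y < z) s.
Proof. by rewrite /= inversions_rcons -cats1 count_cat /=; lia. Qed.

(** Controls an end moving from one extremity of its colour class to the other: the sides of this
    sum count its inversions before and after, so the change has the parity of [size s]. *)
Lemma count_lt_gt x s :
  x \notin s -> count (fun z => z < x) s + count (fun z => x < z) s = size s.
Proof.
elim: s => //= y s IH; rewrite inE negb_or => /andP[xy /IH].
by case: ltngtP xy => //=; lia.
Qed.

Definition colour_degrees (b : bool) (s : seq (bool * nat)) : seq nat :=
  [seq v.2 | v <- s & v.1 == b].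

Fixpoint disorder_count (s : seq (bool * nat)) : nat :=
  if s is v :: s' then
    count (fun u => (v.1 == u.1) && (u.2 < v.2)) s' + disorder_count s'
  else 0.

Lemma disorder_countE (s : seq (bool * nat)) :
  \sum_(0 <= i < size s) \sum_(i.+1 <= j < size s)
     (((nth (true, 0) s i).1 == (nth (true, 0) s j).1)
      && ((nth (true, 0) s j).2 < (nth (true, 0) s i).2)) = disorder_count s.
Proof.
elim: s => [|v s IH] /=; first by rewrite big_nil.
rewrite big_nat_recl //= big_add1 /= -IH; congr (_ + _).
  elim: s {IH} => [|u s IH] /=; first by rewrite big_nil.
  by rewrite big_nat_recl //= IH.
by apply: eq_bigr => i _; rewrite big_add1.
Qed.

Lemma disorder_count_colours s (c : bool) :
  disorder_count s = inversions (colour_degrees c s)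
                     + inversions (colour_degrees (~~ c) s).
Proof.
have cntE (d : nat) b t : count (fun u => (b == u.1) && (u.2 < d)) t
    = count (fun y => y < d) (colour_degrees b t).
  rewrite /colour_degrees count_map count_filter.
  by apply: eq_count => u /=; rewrite andbC eq_sym.
elim: s => //= -[b d] s ->; rewrite cntE /colour_degrees /=.
case: eqP => [->|bc] /=; first by case: (c) => /=; rewrite !addnA.
have -> : b = ~~ c by case: b c bc => [] [].
by rewrite eqxx /=; lia.
Qed.

(** * Splitting the real path into its two colours *)

Fixpoint weave (T : Type) (A B : seq T) : seq T :=
  if A is x :: A' then
    if B is y :: B' then [:: x, y & weave A' B'] else A
  else [::].

Fixpoint unweave (T : Type) (s : seq T) : seq T * seq T :=
  if s is x :: s' then (x :: (unweave s').2, (unweave s').1) else ([::], [::]).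

Lemma size_weave_even (T : Type) (A B : seq T) :
  size A = size B -> size (weave A B) = (size A).*2.
Proof.
by elim: A B => [|x A IH] [|y B] //= [/IH ->]; rewrite doubleS.
Qed.

Lemma size_weave_odd (T : Type) (A B : seq T) :
  size A = (size B).+1 -> size (weave A B) = (size B).*2.+1.
Proof.
by elim: A B => [|x A IH] [|y B] //= [/IH ->].
Qed.

Lemma weaveK_even (T : Type) (A B : seq T) :
  size A = size B -> unweave (weave A B) = (A, B).
Proof. by elim: A B => [|x A IH] [|y B] //= [/IH ->]. Qed.

Lemma weaveK_odd (T : Type) (A B : seq T) :
  size A = (size B).+1 -> unweave (weave A B) = (A, B).
Proof. by elim: A B => [|x A IH] [|y B] //= [] => [/size0nil -> //|/IH ->]. Qed.

Lemma unweaveK (T : Type) (s : seq T) : weave (unweave s).1 (unweave s).2 = s.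
Proof. by elim/pair_ind: s => //= x y s ->. Qed.

Lemma size_unweave (T : Type) (s : seq T) :
  size (unweave s).1 = odd (size s) + size (unweave s).2.
Proof.
by elim: s => //= x s IH; rewrite IH; case: odd => /=; lia.
Qed.

Definition even_tree c (E : seq (seq ptree)) x y O : realtree :=
  (c, weave (y :: O) (rcons E x)).
Definition odd_tree c a (Q : seq (seq ptree)) a' P : realtree :=
  (c, weave (a :: rcons Q a') P).
Definition one_tree c h : realtree := (c, [:: h]).

Inductive realtree_spec : realtree -> Prop :=
| EvenTree c E x y O of size E = size O : realtree_spec (even_tree c E x y O)
| OddTree c a Q a' P of size P = (size Q).+1 : realtree_spec (odd_tree c a Q a' P)
| OneTree c h : realtree_spec (one_tree c h).

Lemma realtreeP T : rt_wf T -> realtree_spec T.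
Proof.
case: T => c hs; rewrite /rt_wf /= => nz.
have := unweaveK hs; have := size_unweave hs.
case: (unweave hs) => [A B] /=; case: odd => /= sz hsE.
- case: A sz hsE => [|a A] //= [sA].
  case/lastP: A sA => [|Q a'] sA hsE.
    by move/esym/size0nil: sA hsE => -> <-; exact: OneTree.
  by rewrite -hsE; apply: (@OddTree c a Q a' B); rewrite size_rcons in sA.
- case/lastP: B sz hsE => [/size0nil -> hsE|E x]; first by rewrite -hsE in nz.
  rewrite size_rcons; case: A => [|y O] //= [sA] <-.
  exact: (@EvenTree c E x y O).
Qed.

(** * Colours and degrees along the real path *)

(* [l] tells whether the first vertex of the list has a real neighbour on its left. *)
Fixpoint path_vertices (l c : bool) (hs : seq (seq ptree)) : seq (bool * nat) :=
  if hs is x :: s then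
    (c (+) odd (size s), 2 * size x + l + (0 < size s)) :: path_vertices true c s
  else [::].

Definition forest_vertices (c : bool) (h : seq ptree) : seq (bool * nat) :=
  flatten [seq pt_vertices c t | t <- h].

Fixpoint hanging_vertices (c : bool) (hs : seq (seq ptree)) : seq (bool * nat) :=
  if hs is x :: s then
    flatten [seq pt_vertices (~~ (c (+) odd (size s))) t
               ++ pt_vertices (~~ (c (+) odd (size s))) t | t <- x]
    ++ hanging_vertices c s
  else [::].

Lemma real_verticesE c hs : real_vertices (c, hs) = path_vertices false c hs.
Proof.
rewrite /real_vertices /rt_color /rt_degree /=.
have -> : path_vertices false c hs =
   [seq (c (+) odd ((size hs).-1 - i),
         2 * size (nth [::] hs i) + (false || (0 < i)) + (i < (size hs).-1))
   | i <- iota 0 (size hs)]; last by [].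
elim: hs false => //= x s IH l; rewrite subn0 orbF IH; congr (_ :: _).
rewrite -[1]/(1 + 0) iotaDl -map_comp; apply: eq_map => i /=.
by rewrite orbT; congr (_ (+) odd _, _ + _); case: s {IH} => [|y s] /=; lia.
Qed.

Lemma all_verticesE c hs :
  all_vertices (c, hs) = path_vertices false c hs ++ hanging_vertices c hs.
Proof.
rewrite /all_vertices real_verticesE; congr (_ ++ _); rewrite /rt_color /=.
elim: hs => //= x s IH; rewrite subn0 -IH; congr (_ ++ flatten _).
rewrite -[1]/(1 + 0) iotaDl -map_comp; apply: eq_map => i /=.
by congr (flatten _); apply: eq_map => t; case: s {IH} => [|y s] //=; rewrite subSS.
Qed.

Lemma disordersE c hs b : disorders (c, hs) =
  inversions (colour_degrees b (path_vertices false c hs)) +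
  inversions (colour_degrees (~~ b) (path_vertices false c hs)).
Proof.
by rewrite /disorders disorder_countE real_verticesE (disorder_count_colours _ b).
Qed.

Definition end_degree (h : seq ptree) := 2 * size h + 1.
Definition inner_degree (h : seq ptree) := 2 * size h + 2.

(** The induction removes the two leftmost vertices: colours are read from the right end, so [c]
    stays, but the new first vertex has a left neighbour, which forces a general [l]. *)
Lemma path_degrees_even l c E x y O : size E = size O ->
  let s := path_vertices l c (weave (y :: O) (rcons E x)) in
  colour_degrees c s = rcons (map inner_degree E) (end_degree x) /\
  colour_degrees (~~ c) s = (2 * size y + l + 1) :: map inner_degree O.
Proof.
rewrite /colour_degrees.
elim: E O l y => [|e E IH] [|o O] l y //= => [_|[sz]].
  by rewrite addbT addbF eqxx; case: (c) => /=; split=> //; rewrite /end_degree addn0.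
have [IH1 IH2] := IH O true o sz; rewrite /= in IH1 IH2.
have -> : size (weave (o :: O) (rcons E x)) = (size O).*2.+2.
  by rewrite size_weave_even ?size_rcons ?sz.
rewrite /= odd_double addbT addbF eqxx.
have -> : (~~ c == c) = false by case: (c).
have -> : (c == ~~ c) = false by case: (c).
by rewrite /= eqxx /= IH1 IH2 /= /inner_degree -!addnA.
Qed.

Lemma path_degrees_odd l c a Q a' P : size P = (size Q).+1 ->
  let s := path_vertices l c (weave (a :: rcons Q a') P) in
  colour_degrees c s =
    (2 * size a + l + 1) :: rcons (map inner_degree Q) (end_degree a') /\
  colour_degrees (~~ c) s = map inner_degree P.
Proof.
rewrite /colour_degrees.
elim: Q P l a => [|q Q IH] [|p P] l a //= [sz].
  move/size0nil: sz => -> /=; rewrite addbT addbF eqxx.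
  by case: (c) => /=; split=> //; rewrite /end_degree /inner_degree -!addnA.
have [IH1 IH2] := IH P true q sz; rewrite /= in IH1 IH2.
have -> : size (weave (q :: rcons Q a') P) = (size P).*2.+1.
  by rewrite size_weave_odd //= size_rcons sz.
rewrite /= odd_double addbT addbF eqxx.
have -> : (~~ c == c) = false by case: (c).
have -> : (c == ~~ c) = false by case: (c).
by rewrite /= eqxx /= IH1 IH2 /= /inner_degree -!addnA.
Qed.

Lemma disorders_even c E x y O : size E = size O ->
  disorders (even_tree c E x y O) =
    inversions (rcons (map inner_degree E) (end_degree x)) +
    inversions (end_degree y :: map inner_degree O).
Proof.
move=> sz; rewrite (disordersE _ _ c).
have [-> ->] := path_degrees_even false c x y sz.
by rewrite addn0.
Qed.

Lemma disorders_odd c a Q a' P : size P = (size Q).+1 ->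
  disorders (odd_tree c a Q a' P) =
    inversions (end_degree a :: rcons (map inner_degree Q) (end_degree a')) +
    inversions (map inner_degree P).
Proof.
move=> sz; rewrite (disordersE _ _ c).
have [-> ->] := path_degrees_odd false c a a' sz.
by rewrite addn0.
Qed.

Lemma disorders_one c h : disorders (one_tree c h) = 0.
Proof. by rewrite (disordersE _ _ c) /colour_degrees /=; case: c. Qed.

(** * Counting all vertices by colour and degree *)

(* The contribution of a real vertex carrying [h] in the upper half-plane; the
   factor 2 accounts for the mirror image of [h]. *)
Definition vertex_count (a : pred (bool * nat)) c d h : nat :=
  a (c, d) + 2 * count a (forest_vertices (~~ c) h).

Definition inner_count a c (s : seq (seq ptree)) : nat :=
  sumn [seq vertex_count a c (inner_degree h) h | h <- s].

Lemma count_hanging (a : pred (bool * nat)) c (x : seq ptree) :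
  count a (flatten [seq pt_vertices c t ++ pt_vertices c t | t <- x]) =
  2 * count a (forest_vertices c x).
Proof.
rewrite /forest_vertices; elim: x => //= t x IH; rewrite !count_cat IH; lia.
Qed.

Lemma inner_count_perm a c s t :
  perm_eq s t -> inner_count a c s = inner_count a c t.
Proof. by move=> st; apply/perm_sumn/perm_map. Qed.

Lemma count_path_even a l c E x y O : size E = size O ->
  let hs := weave (y :: O) (rcons E x) in
  count a (path_vertices l c hs) + count a (hanging_vertices c hs) =
    vertex_count a c (end_degree x) x
    + vertex_count a (~~ c) (2 * size y + l + 1) y
    + inner_count a c E + inner_count a (~~ c) O.
Proof.
rewrite /inner_count /vertex_count.
elim: E O l y => [|e E IH] [|o O] l y //= => [_|[sz]].
  rewrite !count_cat !count_hanging /= !addbT !addbF !negbK !addn0 /end_degree; lia.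
have := IH O true o sz; rewrite /= => IH1.
have -> : size (weave (o :: O) (rcons E x)) = (size O).*2.+2.
  by rewrite size_weave_even ?size_rcons ?sz.
rewrite !count_cat !count_hanging /= odd_double /= !addbT !addbF !negbK.
by rewrite /inner_degree ?negbK -?[_ + 1 + 1]addnA -?[1 + 1]/2 in IH1 *; lia.
Qed.

Lemma count_path_odd a l c b Q b' P : size P = (size Q).+1 ->
  let hs := weave (b :: rcons Q b') P in
  count a (path_vertices l c hs) + count a (hanging_vertices c hs) =
    vertex_count a c (2 * size b + l + 1) b
    + vertex_count a c (end_degree b') b'
    + inner_count a c Q + inner_count a (~~ c) P.
Proof.
rewrite /inner_count /vertex_count.
elim: Q P l b => [|q Q IH] [|p P] l b //= [sz].
  move/size0nil: sz => -> /=.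
  rewrite !count_cat !count_hanging /= !addbT !addbF !negbK !addn0 /end_degree.
  by rewrite /inner_degree -[_ + 1 + 1]addnA -[1 + 1]/2; lia.
have := IH P true q sz; rewrite /= => IH1.
have -> : size (weave (q :: rcons Q b') P) = (size P).*2.+1.
  by rewrite size_weave_odd //= size_rcons sz.
rewrite !count_cat !count_hanging /= odd_double /= !addbT !addbF !negbK.
by rewrite /inner_degree ?negbK -?[_ + 1 + 1]addnA -?[1 + 1]/2 in IH1 *; lia.
Qed.

(** Holding for every [a], such formulas give permutations of [all_vertices] through [permP],
    whatever the order of the interior vertices. *)
Lemma count_even a c E x y O : size E = size O ->
  count a (all_vertices (even_tree c E x y O)) =
    vertex_count a c (end_degree x) x + vertex_count a (~~ c) (end_degree y) y
    + inner_count a c E + inner_count a (~~ c) O.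
Proof.
by move=> sz; rewrite all_verticesE count_cat count_path_even // addn0.
Qed.

Lemma count_odd a c b Q b' P : size P = (size Q).+1 ->
  count a (all_vertices (odd_tree c b Q b' P)) =
    vertex_count a c (end_degree b) b + vertex_count a c (end_degree b') b'
    + inner_count a c Q + inner_count a (~~ c) P.
Proof.
by move=> sz; rewrite all_verticesE count_cat count_path_odd // addn0.
Qed.

Lemma count_one a c h :
  count a (all_vertices (one_tree c h)) = vertex_count a c (2 * size h) h.
Proof.
by rewrite all_verticesE /= cats0 count_hanging addbF !addn0.
Qed.

(** * Pairs of interior vertices *)

Fixpoint pairs_eq (s : seq (seq ptree)) : bool :=
  if s is x :: s1 then
    if s1 is y :: s2 then (size x == size y) && pairs_eq s2 else true
  else true.

Fixpoint swap_pair (s : seq (seq ptree)) : seq (seq ptree) :=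
  if s is x :: s1 then
    if s1 is y :: s2 then
      if size x == size y then [:: x, y & swap_pair s2] else [:: y, x & s2]
    else s
  else s.

Lemma swap_pairK : involutive swap_pair.
Proof.
elim/pair_ind => //= x y s IH; case: eqP => [xy|/eqP xy] /=.
  by rewrite xy eqxx IH.
by rewrite eq_sym (negPf xy).
Qed.

Lemma pairs_eq_swap s : pairs_eq (swap_pair s) = pairs_eq s.
Proof.
elim/pair_ind: s => //= x y s IH; case: eqP => [xy|/eqP xy] /=.
  by rewrite xy eqxx IH.
by rewrite eq_sym (negPf xy).
Qed.

Lemma perm_swap_pair s : perm_eq (swap_pair s) s.
Proof.
elim/pair_ind: s => //= x y s IH; case: eqP => _; first by rewrite !perm_cons.
by apply/permP => a /=; lia.
Qed.

Lemma size_swap_pair s : size (swap_pair s) = size s.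
Proof. exact/perm_size/perm_swap_pair. Qed.

(** Twins tie with each other and have equally many inversions with the later entries; a single last
    entry has none. *)
Lemma odd_inversions_pairs_eq s :
  pairs_eq s -> odd (inversions (map inner_degree s)) = false.
Proof.
elim/pair_ind: s => //= x y s IH /andP[/eqP xy /IH].
by rewrite /inner_degree xy ltnn !oddD => ->; rewrite addbF addbb.
Qed.

Lemma odd_inversions_swap_pair s : ~~ pairs_eq s ->
  odd (inversions (map inner_degree (swap_pair s))) =
  ~~ odd (inversions (map inner_degree s)).
Proof.
elim/pair_ind: s => //= x y s IH; case: eqP => [xy /IH|xy _] /=; last first.
  by rewrite /inner_degree !ltn_add2r !ltn_mul2l /=; case: ltngtP xy => //= _ _; lia.
have /permP cE := perm_map inner_degree (perm_swap_pair s).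
by rewrite !cE !oddD => ->; rewrite !addbN.
Qed.

Lemma inner_end_notin h s : end_degree h \notin map inner_degree s.
Proof.
by apply/mapP => -[x _]; rewrite /end_degree /inner_degree; lia.
Qed.

(** * Effect of the moves on the weight *)

Definition weight_parity (T : realtree) : bool := odd (disorders T) (+) ~~ T.1.

Lemma weight_even c E x y O : size E = size O ->
  weight_parity (even_tree (~~ c) O y x E) = ~~ weight_parity (even_tree c E x y O).
Proof.
move=> sz; rewrite /weight_parity !disorders_even //= !inversions_rcons.
have := count_lt_gt (inner_end_notin x E).
have := count_lt_gt (inner_end_notin y O).
by rewrite !size_map; lia.
Qed.

(** Both ends jump over the same list [Q], so these changes cancel modulo 2; only the comparison
    between the two ends remains. *)
Lemma weight_swap_ends c a Q a' P : size P = (size Q).+1 -> size a != size a' ->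
  weight_parity (odd_tree c a' Q a P) = ~~ weight_parity (odd_tree c a Q a' P).
Proof.
move=> sz aa'; rewrite /weight_parity !disorders_odd // !inversions_ends.
have := count_lt_gt (inner_end_notin a Q).
have := count_lt_gt (inner_end_notin a' Q).
rewrite !size_map /=.
have -> : (end_degree a < end_degree a') = ~~ (end_degree a' < end_degree a).
  by rewrite /end_degree; lia.
by lia.
Qed.

Lemma weight_swap_P c a Q a' P : size P = (size Q).+1 -> ~~ pairs_eq P ->
  weight_parity (odd_tree c a Q a' (swap_pair P)) =
  ~~ weight_parity (odd_tree c a Q a' P).
Proof.
move=> sz /odd_inversions_swap_pair oP; rewrite /weight_parity !disorders_odd //.
  by rewrite !oddD oP !addbN !addNb.
by rewrite size_swap_pair.
Qed.

Lemma weight_swap_Q c a Q a' P : size P = (size Q).+1 -> ~~ pairs_eq Q ->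
  weight_parity (odd_tree c a (swap_pair Q) a' P) =
  ~~ weight_parity (odd_tree c a Q a' P).
Proof.
move=> sz /odd_inversions_swap_pair oQ; rewrite /weight_parity !disorders_odd //;
  last by rewrite size_swap_pair.
have /permP cE := perm_map inner_degree (perm_swap_pair Q).
by rewrite !inversions_ends !cE /=; lia.
Qed.

(** Modulo 2 only the inversions between [Q] and the ends remain: each entry of [Q] forms one with
    exactly one of the two equal ends. *)
Lemma weight_pairs_eq c a Q a' P : size P = (size Q).+1 -> size a = size a' ->
  pairs_eq P -> pairs_eq Q ->
  weight_parity (odd_tree c a Q a' P) = odd (size Q) (+) ~~ c.
Proof.
move=> sz aa' /odd_inversions_pairs_eq oP /odd_inversions_pairs_eq oQ.
rewrite /weight_parity !disorders_odd // !inversions_ends.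
have := count_lt_gt (inner_end_notin a Q).
by rewrite /end_degree -aa' ltnn size_map /= !oddD oP oQ; lia.
Qed.

(** * Folding the real axis into a branch, and unfolding it *)

Definition half1 (l : seq ptree) := take (size l)./2 l.
Definition half2 (l : seq ptree) := drop (size l)./2 l.

(* [t], of colour [c], hangs from the middle of the interior lists [P] (of the
   colour [~~ c] of its parent) and [Q]; its leftmost branch is unfolded onto
   the real axis up to the first vertex of odd degree, each vertex on the way
   being duplicated with half of its remaining children. *)
Fixpoint unfold_branch c t P Q : realtree :=
  let: PNode l := t in
  if odd (size l) then
    if l is t' :: l' then
      unfold_branch (~~ c) t' [:: half1 l', half2 l' & Q] P
    else one_tree c [::]
  else odd_tree c (half1 l) Q (half2 l) P.

(** Used with [n = size Q] and [size P = n.+1]: the interior vertices form [n] pairs and one vertex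
    left over. Each step glues the first pair of [P] into a parent of [t], and the two colours
    exchange roles. *)
Fixpoint fold_branch n c P Q t : realtree :=
  if n is n'.+1 then
    fold_branch n' (~~ c) Q (drop 2 P)
      (PNode (t :: nth [::] P 0 ++ nth [::] P 1))
  else one_tree (~~ c) (t :: nth [::] P 0).

Definition flip (T : realtree) : realtree :=
  let: (c, hs) := T in
  let: (A, B) := unweave hs in
  if size A == size B then (~~ c, weave (rotr 1 B) (rot 1 A)) else
  if A is a :: A' then
    if (A' == [::]) then
      if a is t :: h then unfold_branch (~~ c) t [:: h] [::] else T
    else
    let a' := last a A' in
    let Q := behead (belast a A') in
    if size a != size a' then odd_tree c a' Q a B else
    if ~~ pairs_eq B then odd_tree c a Q a' (swap_pair B) else
    if ~~ pairs_eq Q then odd_tree c a (swap_pair Q) a' B else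
    fold_branch (size Q) c B Q (PNode (a ++ a'))
  else T.

Lemma flip_even c E x y O : size E = size O ->
  flip (even_tree c E x y O) = even_tree (~~ c) O y x E.
Proof.
move=> sz; rewrite /flip /even_tree weaveK_even ?size_rcons /= ?sz // eqxx.
by rewrite rotr1_rcons rot1_cons.
Qed.

Lemma flip_odd c a Q a' P : size P = (size Q).+1 ->
  flip (odd_tree c a Q a' P) =
    if size a != size a' then odd_tree c a' Q a P else
    if ~~ pairs_eq P then odd_tree c a Q a' (swap_pair P) else
    if ~~ pairs_eq Q then odd_tree c a (swap_pair Q) a' P else
    fold_branch (size Q) c P Q (PNode (a ++ a')).
Proof.
move=> sz; rewrite /flip /odd_tree weaveK_odd /= ?size_rcons ?sz //.
rewrite gtn_eqF // last_rcons belast_rcons /=.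
by case: eqP => // /(congr1 size); rewrite size_rcons.
Qed.

Lemma flip_one c t h :
  flip (one_tree c (t :: h)) = unfold_branch (~~ c) t [:: h] [::].
Proof. by []. Qed.

Lemma size_half1 l : size (half1 l) = (size l)./2.
Proof. by rewrite size_takel //; lia. Qed.

Lemma size_half2 l : ~~ odd (size l) -> size (half2 l) = size (half1 l).
Proof. by rewrite size_half1 size_drop; lia. Qed.

Lemma half1_cat (x y : seq ptree) : size x = size y -> half1 (x ++ y) = x.
Proof. by move=> xy; rewrite /half1 size_cat -xy addnn doubleK take_size_cat. Qed.

Lemma half2_cat (x y : seq ptree) : size x = size y -> half2 (x ++ y) = y.
Proof. by move=> xy; rewrite /half2 size_cat -xy addnn doubleK drop_size_cat. Qed.

(** A glued pair has an even number of children besides [t], hence an odd number in all: unfolding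
    goes on through it, and halving recovers the pair. Whether unfolding stops at [t] is left open,
    as the induction requires. *)
Lemma unfold_fold c P Q t : size P = (size Q).+1 -> pairs_eq P -> pairs_eq Q ->
  exists c0 t0 h0, fold_branch (size Q) c P Q t = one_tree c0 (t0 :: h0) /\
    unfold_branch (~~ c0) t0 [:: h0] [::] = unfold_branch c t P Q.
Proof.
move Dn: (size Q) => n; elim: n Q Dn c P t => [|n IH] Q sQ c P t /=.
  case: P => [|h [|//]] //= _ _ _; exists (~~ c), t, h.
  by rewrite negbK (size0nil sQ).
case: P => [|x [|y P]] //= [sP] /andP[/eqP xy pP] pQ.
have := IH P sP (~~ c) Q (PNode (t :: x ++ y)).
rewrite drop0 sQ => /(_ erefl pQ pP) [c0 [t0 [h0 [-> e]]]].
exists c0, t0, h0; rewrite e; split=> //=.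
by rewrite size_cat xy addnn odd_double /= negbK half1_cat ?half2_cat.
Qed.

Lemma pairs_eq_halves l s : ~~ odd (size l) ->
  pairs_eq [:: half1 l, half2 l & s] = pairs_eq s.
Proof. by move=> /size_half2 /= ->; rewrite eqxx. Qed.

(** Induction along the leftmost branch. A vertex with [size l] children has degree [(size l).+1],
    so the descent stops at an even number of children, at the latest at a leaf. *)
Lemma unfold_branchP (R : bool -> ptree -> seq (seq ptree) -> seq (seq ptree) -> Prop) :
  (forall c l P Q, size P = (size Q).+1 -> pairs_eq P -> pairs_eq Q ->
     ~~ odd (size l) -> R c (PNode l) P Q) ->
  (forall c t l P Q, size P = (size Q).+1 -> pairs_eq P -> pairs_eq Q ->
     ~~ odd (size l) -> R (~~ c) t [:: half1 l, half2 l & Q] P ->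
     R c (PNode (t :: l)) P Q) ->
  forall c t P Q, size P = (size Q).+1 -> pairs_eq P -> pairs_eq Q -> R c t P Q.
Proof.
(* [ptree] is nested through [seq]; the explicit fixpoint recurses on the first child only. *)
move=> Rend Rstep c t; move: t c; fix IH 1 => -[l] c P Q sz pP pQ.
case: (boolP (odd (size l))) => [|ev]; last exact: Rend.
case: l => //= t l /= ev; apply: Rstep => //.
by apply: IH; rewrite ?pairs_eq_halves //= sz.
Qed.

Lemma flip_unfold c t P Q : size P = (size Q).+1 -> pairs_eq P -> pairs_eq Q ->
  flip (unfold_branch c t P Q) = fold_branch (size Q) c P Q t.
Proof.
move: c t P Q; refine (@unfold_branchP (fun c t P Q => _ = _) _ _) =>
  [c l P Q sz pP pQ ev|c t l P Q sz pP pQ ev] /=.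
  by rewrite (negPf ev) flip_odd // size_half2 // eqxx pP pQ /= cat_take_drop.
by rewrite ev => ->; rewrite sz /= drop0 negbK cat_take_drop.
Qed.

(** Each step down the branch changes both the colour and the parity of the second list, so the
    right-hand side is constant until the stop. *)
Lemma weight_unfold c t P Q : size P = (size Q).+1 -> pairs_eq P -> pairs_eq Q ->
  weight_parity (unfold_branch c t P Q) = odd (size Q) (+) ~~ c.
Proof.
move: c t P Q; refine (@unfold_branchP (fun c t P Q => _ = _) _ _) =>
  [c l P Q sz pP pQ ev|c t l P Q sz pP pQ ev] /=.
  by rewrite (negPf ev) weight_pairs_eq // size_half2.
by rewrite ev => ->; rewrite sz /=; case: odd; case: (c).
Qed.

Lemma wf_unfold c t P Q : size P = (size Q).+1 -> pairs_eq P -> pairs_eq Q ->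
  rt_wf (unfold_branch c t P Q).
Proof.
move: c t P Q; refine (@unfold_branchP (fun c t P Q => is_true _) _ _) =>
  [c l P Q sz pP pQ ev|c t l P Q sz pP pQ ev] /=; last by rewrite ev.
by rewrite (negPf ev) /rt_wf /odd_tree /=; case: (P).
Qed.

Lemma count_forest_halves a c l : count a (forest_vertices c l) =
  count a (forest_vertices c (half1 l)) + count a (forest_vertices c (half2 l)).
Proof.
rewrite -{1}(cat_take_drop (size l)./2 l) /forest_vertices map_cat flatten_cat.
exact: count_cat.
Qed.

(** A vertex of the branch and its mirror image become two real vertices of the same degree: half of
    the remaining children, doubled by reflection, plus the real edges. *)
Lemma count_unfold a c t P Q : size P = (size Q).+1 -> pairs_eq P -> pairs_eq Q ->
  count a (all_vertices (unfold_branch c t P Q)) =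
    2 * count a (pt_vertices c t) + inner_count a (~~ c) P + inner_count a c Q.
Proof.
move: c t P Q; refine (@unfold_branchP (fun c t P Q => _ = _) _ _) =>
  [c l P Q sz pP pQ ev|c t l P Q sz pP pQ ev] /=.
  rewrite (negPf ev) count_odd // /vertex_count /end_degree size_half2 //.
  rewrite -[flatten _]/(forest_vertices (~~ c) l) (count_forest_halves _ _ l).
  have -> : 2 * size (half1 l) + 1 = (size l).+1.
    by rewrite size_half1; lia.
  by lia.
rewrite ev => ->; rewrite /inner_count /= /vertex_count !negbK.
rewrite -[flatten _]/(forest_vertices (~~ c) l) count_cat (count_forest_halves _ _ l).
rewrite /inner_degree size_half2 //.
have -> : 2 * size (half1 l) + 2 = (size l).+2.
  by rewrite size_half1; lia.
by lia.
Qed.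

(** * The flip is a weight-reversing involution *)

Definition flip_ok (T : realtree) (T' : realtree) :=
  [/\ rt_wf T', perm_eq (all_vertices T') (all_vertices T),
      flip T' = T & weight_parity T' = ~~ weight_parity T].

Lemma flip_one_ok c t h : flip_ok (one_tree c (t :: h)) (flip (one_tree c (t :: h))).
Proof.
rewrite flip_one; split; first exact: wf_unfold.
- apply/permP => a; rewrite count_unfold // count_one /inner_count /= negbK.
  rewrite /vertex_count /inner_degree /=.
  rewrite -[forest_vertices _ (t :: h)]/(pt_vertices _ t ++ forest_vertices _ h).
  rewrite count_cat.
  have -> : 2 * (size h).+1 = 2 * size h + 2 by lia.
  by lia.
- by rewrite flip_unfold //= negbK.
- by rewrite weight_unfold // /weight_parity disorders_one.
Qed.

Lemma flip_okP T : rt_wf T -> T.2 != [:: [::]] -> flip_ok T (flip T).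
Proof.
case/realtreeP => [c E x y O sz|c b Q b' P sz|c [|t h]] nz;
  [| | by rewrite eqxx in nz | exact: flip_one_ok].
  rewrite flip_even //; split; first by case: (O).
  - by apply/permP => a; rewrite !count_even // negbK; lia.
  - by rewrite flip_even // negbK.
  - exact: weight_even.
rewrite flip_odd //; case: ifP => [bb'|/eqP bb'].
  split; first by rewrite /rt_wf /odd_tree; case: (P).
  - by apply/permP => a; rewrite !count_odd //; lia.
  - by rewrite flip_odd // eq_sym bb'.
  - exact: weight_swap_ends.
case: ifP => [pP|/negbFE pP].
  have sz' : size (swap_pair P) = (size Q).+1 by rewrite size_swap_pair.
  split; first by rewrite /rt_wf /odd_tree; case: (swap_pair P).
  - apply/permP => a; rewrite !count_odd //.
    by rewrite (inner_count_perm _ _ (perm_swap_pair P)).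
  - by rewrite flip_odd // bb' eqxx pairs_eq_swap pP /= swap_pairK.
  - exact: weight_swap_P.
case: ifP => [pQ|/negbFE pQ].
  have sz' : size P = (size (swap_pair Q)).+1 by rewrite size_swap_pair.
  split; first by rewrite /rt_wf /odd_tree; case: (P).
  - apply/permP => a; rewrite !count_odd //.
    by rewrite (inner_count_perm _ _ (perm_swap_pair Q)).
  - by rewrite flip_odd // bb' eqxx pairs_eq_swap pP pQ /= swap_pairK.
  - exact: weight_swap_Q.
have [c0 [t0 [h0 [-> e]]]] := unfold_fold c (PNode (b ++ b')) sz pP pQ.
(* Unfolding stops at [b ++ b'], which has even size. Thus the tree at hand is the flip of a
   one-vertex tree, and the claims for that tree are read backwards. *)
have e' : flip (one_tree c0 (t0 :: h0)) = odd_tree c b Q b' P.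
  by rewrite flip_one e /= size_cat bb' addnn odd_double half1_cat ?half2_cat.
have [_ pv _ w] := flip_one_ok c0 t0 h0; rewrite e' in pv w.
by split; rewrite // ?w ?negbK // perm_sym.
Qed.

(** * Cancellation in the signed sum *)

Local Open Scope ring_scope.

Lemma sum_sign_reversing (T : eqType) (s : seq T) (f : T -> T) (F : T -> int) :
  uniq s -> {in s, forall x, f x \in s} -> {in s, cancel f f} ->
  {in s, forall x, F (f x) = - F x} -> \sum_(x <- s) F x = 0.
Proof.
move=> us fs fK Ff; apply/eqP; rewrite -eqNr -sumrN.
have sf : perm_eq s (map f s).
  apply: uniq_perm => //; first by rewrite map_inj_in_uniq //; exact: can_in_inj fK.
  move=> x; apply/idP/mapP => [xs|[y ys ->]]; last exact: fs.
  by exists (f x); [exact: fs | rewrite fK].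
rewrite [X in _ == X](perm_big _ sf) big_map; apply/eqP.
by rewrite !big_seq; apply: eq_bigr => x xs; rewrite Ff.
Qed.

Lemma passport_perm Lw Lb T T' : perm_eq (all_vertices T') (all_vertices T) ->
  rt_wf T' -> has_passport Lw Lb T -> has_passport Lw Lb T'.
Proof.
move=> p wf /andP[/andP[_ pw] pb]; rewrite /has_passport wf /=.
apply/andP; split.
  by apply: perm_trans pw; apply/perm_map/perm_filter.
by apply: perm_trans pb; apply/perm_map/perm_filter.
Qed.

(** A lone point has degree 0, which is not a positive part; this excludes the tree with no branch
    to unfold. *)
Lemma passport_neq_point Lw Lb T : all (fun x => (0 < x)%N) Lw ->
  all (fun x => (0 < x)%N) Lb -> has_passport Lw Lb T -> T.2 != [:: [::]].
Proof.
case: T => c hs pw pb /andP[/andP[_ /perm_all qw] /perm_all qb].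
rewrite -qw in pw; rewrite -qb in pb.
by apply: contraL pw => /eqP /= hsE; move: pb; rewrite hsE; case: (c).
Qed.

(* sW (resp. sB) is a duplicate-free enumeration of W_{Lw,Lb} (resp. B_{Lw,Lb}) *)
Theorem theorem3p9 (n : nat) (Lw Lb : seq nat) (sW sB : seq realtree) :
  (0 < n)%N -> is_partition n Lw -> is_partition n Lb ->
  uniq sW -> (forall T, (T \in sW) = inW Lw Lb T) ->
  uniq sB -> (forall T, (T \in sB) = inB Lw Lb T) ->
  \sum_(T <- sW) rt_sign T - \sum_(T <- sB) rt_sign T = 0.
Proof.
move=> _ /andP[Lw0 _] /andP[Lb0 _] uW sWE uB sBE.
pose F T : int := (-1) ^+ weight_parity T.
have memE T : (T \in sW ++ sB) = has_passport Lw Lb T.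
  by rewrite mem_cat sWE sBE /inW /inB /white_side /black_side -andb_orr orbN andbT.
have -> : \sum_(T <- sW) rt_sign T - \sum_(T <- sB) rt_sign T
          = \sum_(T <- sW ++ sB) F T.
  rewrite big_cat -sumrN !big_seq; congr (_ + _); apply: eq_bigr => T.
    rewrite sWE /inW /white_side => /andP[_ Tw].
    by rewrite /F /weight_parity Tw addbF signr_odd.
  rewrite sBE /inB /black_side => /andP[_ Tb].
  by rewrite /F /weight_parity Tb addbT signrN signr_odd.
have ok T : T \in sW ++ sB -> flip_ok T (flip T).
  rewrite memE => pT; apply: flip_okP; first by case/andP: pT => /andP[].
  exact: passport_neq_point pT.
apply: (@sum_sign_reversing _ _ flip).
- rewrite cat_uniq uW uB andbT /=; apply/hasPn => T.
  by rewrite sBE sWE /inW /inB /black_side /white_side => /andP[_ /negPf ->]; rewrite andbF.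
- move=> T Ts; have [wf p _ _] := ok T Ts.
  by rewrite memE; apply: passport_perm p wf _; rewrite -memE.
- by move=> T /ok[].
- by move=> T /ok[_ _ _ w]; rewrite /F w signrN.
Qed.
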